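(* Let $G$ be a finite simple graph with vertex set $V$. For each $v\in V$ and $X\subseteq V$, let $d_X(v)$ be the number of neighbors of $v$ in $X$, and let $K:=\max_{\emptyset\ne X\subseteq V}\rho\big((d_X(v))_{v\in V}\big)$. Then $$\mathcal M(G)\le\lambda_{\max}(G)\le\sqrt{2(\log K+1)(\log|V|+4)}\,\mathcal M(G).$$
   Context: $\lambda_{\max}(G)$ is the largest eigenvalue of the adjacency matrix $A$ of $G$. For $X,Y\subseteq V$, $e(X,Y)$ is the number of ordered pairs $(x,y)\in X\times Y$ with $xy$ an edge (equivalently $\xi^tA\eta$ for the characteristic vectors $\xi,\eta$). $\mathcal M(G):=\max_{\emptyset\ne X,Y\subseteq V}e(X,Y)/\sqrt{|X||Y|}$. For a finite sequence $d$ of non-negative reals, let $d_1\ge\dots\ge d_n\ge0$ be its non-increasing rearrangement, let $k\in[1,n]$ be the smallest positive integer with $d_1^2+\dots+d_k^2\ge d_{k+1}^2+\dots+d_n^2$, and set $\rho(d):=d_1/d_k$ if $d_k\ne0$ and $\rho(d):=1$ if $d_k=0$. $\log$ is the natural logarithm. *)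

(* Defs.v *)
From HB Require Import structures.
From mathcomp Require Import classical_sets reals exp.
From mathcomp Require Import all_boot all_order all_algebra.

Set Implicit Arguments.
Unset Strict Implicit.
Unset Printing Implicit Defensive.

Import Order.TTheory GRing.Theory Num.Theory.
Local Open Scope ring_scope.

(* A finite simple graph on the vertex set T is encoded as
   a symmetric irreflexive relation e : rel T on the finite type T. *)

Definition adjacency (R : realType) (T : finType) (e : rel T) : 'M[R]_#|T| :=
  \matrix_(i, j) (e (enum_val i) (enum_val j))%:R.

(* The set of eigenvalues is finite, and nonempty when A is symmetric with
   0 < n, so this supremum is then a maximum. *)
Definition largest_eigenvalue (R : realType) (n : nat) (A : 'M[R]_n) : R :=
  sup [set a : R | eigenvalue A a]%classic.

Definition lambda_max (R : realType) (T : finType) (e : rel T) : R :=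
  largest_eigenvalue (adjacency R e).

Definition edge_count (T : finType) (e : rel T) (X Y : {set T}) : nat :=
  #|[set p : T * T | [&& p.1 \in X, p.2 \in Y & e p.1 p.2]]|.

(* The default 0 of the maximum is harmless: every quotient is nonnegative. *)
Definition calM (R : realType) (T : finType) (e : rel T) : R :=
  \big[Num.max/0]_(P : {set T} * {set T} | (P.1 != set0) && (P.2 != set0))
     ((edge_count e P.1 P.2)%:R / Num.sqrt (#|P.1|%:R * #|P.2|%:R)).

Definition degree_in (T : finType) (e : rel T) (X : {set T}) (v : T) : nat :=
  #|[set x in X | e v x]|.

(* For s = [:: d_1; ...; d_n] with n > 0, the least k in [1, n] such that
   d_1^2 + ... + d_k^2 >= d_(k+1)^2 + ... + d_n^2.  The entry d_i is s`_(i.-1),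
   and [find] over 0, ..., n returns the value k itself; k = n always
   qualifies. *)
Definition half_energy_index (R : realType) (s : seq R) : nat :=
  find (fun k => (0 < k)%N &&
          (\sum_(k <= i < size s) s`_i ^+ 2 <= \sum_(0 <= i < k) s`_i ^+ 2))
       (iota 0 (size s).+1).

Definition rho (R : realType) (d : seq R) : R :=
  let s := sort >=%R d in
  let dk := s`_(half_energy_index s).-1 in
  if dk != 0 then s`_0 / dk else 1.

(* The default 0 is harmless: rho is positive on nonnegative sequences. *)
Definition max_rho (R : realType) (T : finType) (e : rel T) : R :=
  \big[Num.max/0]_(X : {set T} | X != set0)
     rho [seq (degree_in e X v)%:R : R | v <- enum T].

(* Main.v *)
(* Upper bound.  Let f be an eigenvector for an eigenvalue a, g = |f|, so that
   |a| g <= A g entrywise.  If |A 1_X|^2 <= C^2 |X| for all X, then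
   <1_X, A g> = <A 1_X, g> <= C sqrt|X| |g|, so the sum of the j largest entries
   of A g is at most C |g| sqrt j.  Summation by parts against the steps
   sqrt (i + 1) - sqrt i, whose squares sum to at most (log n + 3) / 2, yields
   |A g|^2 <= C^2 |g|^2 (log n + 3) / 2.  The same partial-sum bound for the
   decreasing rearrangement d of A 1_X, with constant M sqrt|X|, gives
   i d_i^2 <= M^2 |X|; for i <= k the d_i lie in [d_1 / K, d_1], so the harmonic
   sum of these bounds is only logarithmic in K, and the first k terms carry at
   least half of |A 1_X|^2.

   Lower bound.  The least mu with mu I - A positive semidefinite is an
   eigenvalue, since an invertible positive semidefinite matrix is coercive;
   for nonnegative A it also bounds <x, A y> / (|x| |y|). *)
Require Import Defs.
From HB Require Import structures.
From mathcomp Require Import classical_sets reals exp.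
From mathcomp Require Import all_boot all_order all_algebra.
From mathcomp Require Import ring lra.

Set Implicit Arguments.
Unset Strict Implicit.
Unset Printing Implicit Defensive.

Import Order.TTheory GRing.Theory Num.Theory.
Local Open Scope ring_scope.

(** * Discriminants of nonnegative quadratic forms *)

Lemma discriminant_le (R : realFieldType) (a b c : R) :
  (forall s t, 0 <= s ^+ 2 * a + 2 * (s * t) * b + t ^+ 2 * c) ->
  b ^+ 2 <= a * c.
Proof.
move=> H; have c_ge0 : 0 <= c by have := H 0 1; lra.
have [c0|c_neq0] := eqVneq c 0; last first.
  have c_gt0 : 0 < c by rewrite lt0r c_neq0.
  (* At [(c, - b)] the form equals [c * (a * c - b ^+ 2)]. *)
  by rewrite -(ler_pM2l c_gt0); have := H c (- b); lra.
have [->|b_neq0] := eqVneq b 0; first by rewrite c0; lra.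
(* With [c = 0] and [s = 1] the form is affine in [t]; this [t] makes it [- 1]. *)
have := H 1 (- (a + 1) / (2 * b)); rewrite c0.
suff -> : 1 ^+ 2 * a + 2 * (1 * (- (a + 1) / (2 * b))) * b +
  (- (a + 1) / (2 * b)) ^+ 2 * 0 = - 1 by lra.
by field.
Qed.

Lemma cauchy_schwarz (R : realFieldType) (I : finType) (f g : I -> R) :
  (\sum_i f i * g i) ^+ 2 <= (\sum_i f i ^+ 2) * (\sum_i g i ^+ 2).
Proof.
apply: discriminant_le => s t; rewrite !mulr_sumr -!big_split /=.
apply: sumr_ge0 => i _.
suff -> : s ^+ 2 * f i ^+ 2 + 2 * (s * t) * (f i * g i) + t ^+ 2 * g i ^+ 2 =
  (s * f i + t * g i) ^+ 2 by exact: sqr_ge0.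
ring.
Qed.

(** * Forms of symmetric matrices and the Rayleigh bound *)

Section BilinearForm.
Variables (R : realType) (n : nat).
Implicit Types (A B : 'M[R]_n) (u v : 'rV[R]_n).

Definition bform A u v : R := (u *m A *m v^T) 0 0.

Lemma bformE A u v : bform A u v = \sum_i \sum_j u 0 i * A i j * v 0 j.
Proof.
rewrite exchange_big /bform mxE; apply: eq_bigr => j _ /=.
by rewrite !mxE mulr_suml.
Qed.

Lemma bform1E u : bform 1%:M u u = \sum_i u 0 i ^+ 2.
Proof.
by rewrite /bform mulmx1 mxE; apply: eq_bigr => i _; rewrite mxE expr2.
Qed.

Lemma bform1_ge0 u : 0 <= bform 1%:M u u.
Proof. by rewrite bform1E sumr_ge0 // => i _; rewrite sqr_ge0. Qed.

Lemma bform1_eq0 u : (bform 1%:M u u == 0) = (u == 0).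
Proof.
apply/idP/eqP => [|->]; last by rewrite /bform !mul0mx mxE.
rewrite bform1E psumr_eq0 => [/allP u0|i _]; last exact: sqr_ge0.
apply/rowP => i; rewrite mxE; apply/eqP.
by rewrite -sqrf_eq0; apply: u0; rewrite mem_index_enum.
Qed.

Lemma bform_comb A u v s t : A^T = A ->
  bform A (s *: u + t *: v) (s *: u + t *: v) =
  s ^+ 2 * bform A u u + 2 * (s * t) * bform A u v + t ^+ 2 * bform A v v.
Proof.
move=> symA; have bformC : bform A v u = bform A u v.
  rewrite /bform (_ : v *m A *m u^T = (u *m A *m v^T)^T); first exact: mxE.
  by rewrite !trmx_mul trmxK symA mulmxA.
have bformDl x y z : bform A (x + y) z = bform A x z + bform A y z.
  by rewrite /bform !mulmxDl mxE.
have bformDr x y z : bform A z (x + y) = bform A z x + bform A z y.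
  by rewrite /bform linearD mulmxDr mxE.
have bformZl a x z : bform A (a *: x) z = a * bform A x z.
  by rewrite /bform -!scalemxAl mxE.
have bformZr a x z : bform A z (a *: x) = a * bform A z x.
  by rewrite /bform linearZ /= -scalemxAr mxE.
by rewrite !(bformDl, bformDr, bformZl, bformZr) bformC; ring.
Qed.

Lemma psd_cauchy_schwarz A u v : A^T = A -> (forall w, 0 <= bform A w w) ->
  bform A u v ^+ 2 <= bform A u u * bform A v v.
Proof.
move=> symA psdA; apply: discriminant_le => s t.
by rewrite -bform_comb.
Qed.

Lemma bform_le A : exists2 N, 0 < N & forall u, bform A u u <= N * bform 1%:M u u.
Proof.
(* The summand 1 makes the bound positive even for [A = 0]. *)
exists (1 + \sum_i \sum_j `|A i j|).
  by rewrite ltr_pwDl ?ltr01 // sumr_ge0 // => i _; rewrite sumr_ge0.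
move=> u; have u_ge0 := bform1_ge0 u.
apply: (@le_trans _ _ ((\sum_i \sum_j `|A i j|) * bform 1%:M u u)); last first.
  by rewrite mulrDl mul1r lerDr.
rewrite bformE mulr_suml; apply: ler_sum => i _.
rewrite mulr_suml; apply: ler_sum => j _.
have coord k : u 0 k ^+ 2 <= bform 1%:M u u.
  rewrite bform1E (bigD1 k) //= lerDl sumr_ge0 // => l _; exact: sqr_ge0.
apply: le_trans (ler_norm _) _.
rewrite mulrAC mulrC normrM ler_wpM2l // normrM.
have := coord i; have := coord j; rewrite -(normr_id (u 0 i)).
rewrite -[u 0 i ^+ 2]real_normK ?num_real // -[u 0 j ^+ 2]real_normK ?num_real //.
rewrite normr_id; have := sqr_ge0 (`|u 0 i| - `|u 0 j|); lra.
Qed.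

(** For [y = u A], Cauchy-Schwarz for the form of [A] gives
    [|y|^4 <= A(u,u) A(y,y) <= A(u,u) N |y|^2], hence [|y|^2 <= N A(u,u)]. Boundedness of the
    inverse gives [|u|^2 <= N' |y|^2]. *)
Lemma invertible_psd_coercive A : A^T = A -> A \in unitmx ->
  (forall u, 0 <= bform A u u) ->
  exists2 eps, 0 < eps & forall u, eps * bform 1%:M u u <= bform A u u.
Proof.
move=> symA unitA psdA.
have [N N_gt0 leN] := bform_le A.
have [N' N'_gt0 leN'] := bform_le (invmx A *m (invmx A)^T).
exists (N * N')^-1; first by rewrite invr_gt0 mulr_gt0.
move=> u; rewrite ler_pdivrMl ?mulr_gt0 //.
pose y := u *m A; have yV : y *m invmx A = u by rewrite mulmxK.
have uE : bform 1%:M u u = bform (invmx A *m (invmx A)^T) y y.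
  by rewrite /bform mulmx1 mulmxA yV -mulmxA -trmx_mul yV.
rewrite uE; apply: le_trans (leN' y) _.
rewrite [N * N']mulrC -mulrA ler_pM2l //.
have yE : bform 1%:M y y = bform A u y by rewrite /bform mulmx1.
have := psd_cauchy_schwarz u y symA psdA; rewrite -yE => le2.
have [->|y_neq0] := eqVneq (bform 1%:M y y) 0; first by rewrite mulr_ge0 // ltW.
have y_gt0 : 0 < bform 1%:M y y by rewrite lt0r y_neq0 bform1_ge0.
rewrite -(ler_pM2r y_gt0) -expr2; apply: le_trans le2 _.
by rewrite [N * _]mulrC -mulrA ler_wpM2l.
Qed.

Lemma bform_shift A t u : bform (t%:M - A) u u = t * bform 1%:M u u - bform A u u.
Proof.
rewrite /bform mulmxBr mulmxBl mul_mx_scalar -scalemxAl mulmx1.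
by rewrite mxE [X in X + _]mxE [X in _ + X]mxE.
Qed.

Lemma rayleigh_eigenvalue A : (0 < n)%N -> A^T = A ->
  exists2 mu, eigenvalue A mu & forall u, bform A u u <= mu * bform 1%:M u u.
Proof.
move=> n_gt0 symA.
pose P := [set t : R | forall u, bform A u u <= t * bform 1%:M u u]%classic.
have P0 : (P !=set0)%classic by have [N _ leN] := bform_le A; exists N.
have lbP u : u != 0 -> lbound P (bform A u u / bform 1%:M u u).
  move=> u_neq0 t Pt; rewrite ler_pdivrMr; first exact: Pt.
  by rewrite lt0r bform1_eq0 u_neq0 bform1_ge0.
(* Since [0 < n], a nonzero vector exists; its Rayleigh quotient bounds [P] from below. *)
pose u0 : 'rV[R]_n := const_mx 1.
have u0_neq0 : u0 != 0.
  apply/eqP => /rowP/(_ (Ordinal n_gt0))/eqP.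
  by rewrite !mxE oner_eq0.
have hlbP : has_lbound P by exists (bform A u0 u0 / bform 1%:M u0 u0); exact: lbP.
(* The infimum is attained: every Rayleigh quotient is a lower bound of [P], hence at most
   [inf P]. *)
have Pmu : P (inf P).
  move=> u; have [->|u_neq0] := eqVneq u 0.
    by rewrite /bform !mul0mx !mxE mulr0.
  rewrite -ler_pdivrMr; last by rewrite lt0r bform1_eq0 u_neq0 bform1_ge0.
  by apply: lb_le_inf => //; exact: lbP.
exists (inf P); last by [].
apply: contraT => nev; pose B := (inf P)%:M - A.
have unitB : B \in unitmx.
  move: nev; rewrite /eigenvalue negbK kermx_eq0 row_free_unit.
  by rewrite -opprB /B -scaleN1r unitmxZ // unitrN1.
have symB : B^T = B by rewrite /B linearB /= tr_scalar_mx symA.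
have psdB u : 0 <= bform B u u by rewrite bform_shift subr_ge0; exact: Pmu.
have [eps eps_gt0 leB] := invertible_psd_coercive symB unitB psdB.
(* Coercivity leaves room to lower the infimum, a contradiction. *)
have : P (inf P - eps).
  move=> u; have := leB u; rewrite bform_shift; lra.
move=> /(ge_inf hlbP); lra.
Qed.

End BilinearForm.

(** * Summation by parts and logarithmic estimates *)

Lemma abel_ge0 (R : realDomainType) (u z : nat -> R) (n : nat) :
  (forall i, 0 <= u i) -> (forall i, u i.+1 <= u i) ->
  (forall j, (j <= n)%N -> 0 <= \sum_(0 <= i < j) z i) ->
  0 <= \sum_(0 <= i < n) u i * z i.
Proof.
move=> u_ge0 u_le z_ge0.
(* Strengthened for the induction: [u n], one index past the end, is at most every weight in the
   sum. *)
suff : u n * (\sum_(0 <= i < n) z i) <= \sum_(0 <= i < n) u i * z i.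
  by apply: le_trans; rewrite mulr_ge0 // z_ge0.
elim: n z_ge0 => [|n IHn] z_ge0; first by rewrite !big_geq ?mulr0.
rewrite [leRHS]big_nat_recr //=.
apply: (@le_trans _ _ (u n * \sum_(0 <= i < n.+1) z i)).
  by rewrite ler_wpM2r // z_ge0.
rewrite big_nat_recr //= mulrDr lerD2r; apply: IHn => j le_jn.
by apply: z_ge0; rewrite leqW.
Qed.

(** This is [ln (1 + x) <= x] at [x = - 1 / (i + 1)]. *)
Lemma inv_succ_le_ln (R : realType) (i : nat) : (0 < i)%N ->
  i.+1%:R^-1 <= ln i.+1%:R - ln (i%:R : R).
Proof.
move=> i_gt0; have i_pos : 0 < i%:R :> R by rewrite ltr0n.
have S_pos : 0 < i.+1%:R :> R by rewrite ltr0n.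
rewrite -ln_div ?posrE // -lerN2 -lnV ?posrE ?divr_gt0 // invf_div.
have -> : i%:R / i.+1%:R = 1 + - i.+1%:R^-1 :> R.
  by rewrite -natr1; field; rewrite natr1 gt_eqF.
by apply: le_ln1Dx; rewrite ltrN2 invf_lt1 // ltr1n.
Qed.

Definition sqrt_step (R : realType) (i : nat) : R :=
  Num.sqrt i.+1%:R - Num.sqrt i%:R.

Lemma sum_sqrt_step (R : realType) (n : nat) :
  \sum_(0 <= i < n) sqrt_step R i = Num.sqrt n%:R.
Proof. by rewrite telescope_sumr // sqrtr0 subr0. Qed.

Lemma sqrt_step_sq_le (R : realType) (i : nat) : (0 < i)%N ->
  sqrt_step R i ^+ 2 <= (2 * i.+1%:R)^-1.
Proof.
move=> i_gt0; rewrite /sqrt_step.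
set p := Num.sqrt _; set q := Num.sqrt _.
have pE : p ^+ 2 = i.+1%:R by rewrite sqr_sqrtr.
have qE : q ^+ 2 = i%:R by rewrite sqr_sqrtr.
have q_ge1 : 1 <= q by rewrite -[leLHS]sqrtr1 ler_sqrt // ler1n.
have qp : q <= p by rewrite ler_sqrt // ler_nat.
have p_gt0 : 0 < p by lra.
rewrite -pE -[leRHS]mul1r ler_pdivlMr; last by rewrite mulr_gt0 ?exprn_gt0.
have pqE : p ^+ 2 = q ^+ 2 + 1 by rewrite pE qE natr1.
(* It remains to see [2 * p ^+ 2 <= (p + q) ^+ 2], which follows from [p ^+ 2 = q ^+ 2 + 1] and
   [1 <= p * q]. *)
have pq1 : (p - q) ^+ 2 * (p + q) ^+ 2 = 1.
  by rewrite -exprMn -subr_sqr pqE [_ + 1]addrC addrK expr1n.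
rewrite -[leRHS]pq1; apply: ler_wpM2l; first exact: sqr_ge0.
have : 1 * 1 <= p * q by apply: ler_pM => //; lra.
lra.
Qed.

(** The term at 0 is 1; the later ones are at most half the terms of a harmonic sum, which
    telescopes against [ln]. *)
Lemma sum_sqrt_step_sq (R : realType) (n : nat) : (0 < n)%N ->
  \sum_(0 <= i < n) sqrt_step R i ^+ 2 <= (ln n%:R + 3) / 2.
Proof.
case: n => // n _; elim: n => [|n IHn].
  by rewrite big_nat1 /sqrt_step sqrtr1 sqrtr0 subr0 ln1; lra.
rewrite big_nat_recr //=.
move: (@sqrt_step_sq_le R n.+1 isT) (@inv_succ_le_ln R n.+1 isT) IHn.
rewrite invfM; set l := ln _; set l' := ln _; set S := \sum_(_ <= _ < _) _.
by set c := _ ^+ 2; set r := _%:R^-1; lra.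
Qed.

(* The partial sums of the extremal sequence [C * sqrt_step] are exactly
   [C * Num.sqrt j], and summation by parts compares [u] to it. *)
Lemma sum_sq_le_of_partial_sums (R : realType) (u : nat -> R) (n : nat) (C : R) :
  (0 < n)%N -> 0 <= C ->
  (forall i, 0 <= u i) -> (forall i, u i.+1 <= u i) ->
  (forall j, (j <= n)%N -> \sum_(0 <= i < j) u i <= C * Num.sqrt j%:R) ->
  \sum_(0 <= i < n) u i ^+ 2 <= C ^+ 2 * ((ln n%:R + 3) / 2).
Proof.
move=> n_gt0 C_ge0 u_ge0 u_le leC.
pose S := \sum_(0 <= i < n) u i ^+ 2.
pose D := \sum_(0 <= i < n) sqrt_step R i ^+ 2.
apply: (@le_trans _ _ (C ^+ 2 * D)); last first.
  by rewrite ler_wpM2l ?sqr_ge0 // sum_sqrt_step_sq.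
have S_ge0 : 0 <= S by apply: sumr_ge0 => i _; exact: sqr_ge0.
have D_ge0 : 0 <= D by apply: sumr_ge0 => i _; exact: sqr_ge0.
pose X := \sum_(0 <= i < n) u i * sqrt_step R i.
have SX : S <= C * X.
  rewrite -subr_ge0.
  have -> : C * X - S = \sum_(0 <= i < n) u i * (C * sqrt_step R i - u i).
    rewrite mulr_sumr -sumrB; apply: eq_bigr => i _; ring.
  apply: abel_ge0 => // j le_jn.
  by rewrite sumrB -mulr_sumr sum_sqrt_step subr_ge0 leC.
have X2 : X ^+ 2 <= S * D.
  rewrite /X /S /D !big_mkord; exact: cauchy_schwarz.
(* Combining [SX] and [X2] gives [S ^+ 2 <= C ^+ 2 * (S * D)]; a nonzero [S] can be cancelled. *)
have [S0|S_neq0] := eqVneq S 0; first by rewrite -/S S0 mulr_ge0 // sqr_ge0.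
have S_gt0 : 0 < S by rewrite lt0r S_neq0.
rewrite -(ler_pM2l S_gt0) -expr2.
apply: (@le_trans _ _ ((C * X) ^+ 2)).
  by rewrite ler_sqr ?nnegrE // (le_trans S_ge0).
by rewrite exprMn [leRHS]mulrCA ler_wpM2l ?sqr_ge0.
Qed.

(** Each term is at most the minimum of [a] and [1 / (i + 1)]. Terms with [a * (i + 1) <= 1] add up
    to at most 1, the one crossing that threshold adds at most 1, and the harmonic rest gives the
    logarithm. *)
Lemma sum_min_harmonic_le (R : realType) (u : nat -> R) (a : R) (k : nat) :
  0 <= a -> (forall i, (i < k)%N -> u i <= a) ->
  (forall i, (i < k)%N -> i.+1%:R * u i <= 1) ->
  \sum_(0 <= i < k) u i <= 2 + ln (Num.max 1 (a * k%:R)).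
Proof.
move=> a_ge0.
have lin n : (forall i, (i < n)%N -> u i <= a) ->
    \sum_(0 <= i < n) u i <= a * n%:R.
  move=> ua; rewrite big_mkord mulr_natr.
  rewrite -[in leRHS](card_ord n) -sumr_const.
  by apply: ler_sum => i _; exact: ua.
elim: k => [|k IHk] ua uh.
  by rewrite big_geq // addr_ge0 // ln_ge0 // le_max lexx.
have [le1|gt1] := leP (a * k.+1%:R) 1.
  by rewrite ln1; have := lin _ ua; lra.
have {}IHk : \sum_(0 <= i < k) u i <= 2 + ln (Num.max 1 (a * k%:R)).
  by apply: IHk => i ik; [apply: ua | apply: uh]; rewrite ltnW.
have uk : u k <= k.+1%:R^-1.
  by rewrite -[leRHS]mul1r ler_pdivlMr ?ltr0n // mulrC uh.
rewrite big_nat_recr //=; move: IHk.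
have ln_pos : 0 <= ln (a * k.+1%:R) by rewrite ln_ge0 // ltW.
have inv_le1 : k.+1%:R^-1 <= 1 :> R by rewrite invf_le1 ?ltr0n // ler1n.
(* The crossing term: here [a * k <= 1 < a * (k + 1)]. *)
have [le1 _|gt1'] := leP (a * k%:R) 1.
  have : \sum_(0 <= i < k) u i <= a * k%:R.
    by apply: lin => i ik; apply: ua; rewrite ltnW.
  move: le1 ln_pos inv_le1 uk; set l := ln _; set r := _^-1; lra.
have ak_gt0 : 0 < a * k%:R by lra.
have k_gt0 : (0 < k)%N.
  by rewrite lt0n; apply: contraTneq ak_gt0 => ->; rewrite mulr0 ltxx.
have a_gt0 : 0 < a by move: ak_gt0; rewrite pmulr_lgt0 // ltr0n.
rewrite !lnM ?posrE ?ltr0n //; move: (@inv_succ_le_ln R k k_gt0) uk.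
set l := ln k%:R; set l' := ln _.+1%:R; set r := _^-1; lra.
Qed.

(** * Decreasing rearrangements and the half-energy index *)

Section SortedSequence.
Variables (R : realType) (d : seq R).
Hypothesis d_ge0 : forall x, x \in d -> 0 <= x.
Let s := sort >=%R d.
Let k := half_energy_index s.

Lemma nth_sort_ge0 i : 0 <= s`_i.
Proof.
have [lt_i|ge_i] := ltnP i (size s); last by rewrite nth_default.
by apply: d_ge0; rewrite -(mem_sort >=%R) mem_nth.
Qed.

Lemma nth_sort_le i j : (i <= j)%N -> s`_j <= s`_i.
Proof.
move=> le_ij; have [lt_j|ge_j] := ltnP j (size s); last first.
  by rewrite [leLHS]nth_default // nth_sort_ge0.
apply: (@sorted_leq_nth _ >=%R _ _ 0 s) => //.
- by move=> x y z yx zy; exact: le_trans zy yx.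
- exact: lexx.
- by apply: sort_sorted => x y; exact: le_total.
- by rewrite inE (leq_ltn_trans le_ij).
Qed.

Lemma sum_sort_sq : \sum_(x <- d) x ^+ 2 = \sum_(0 <= i < size s) s`_i ^+ 2.
Proof.
rewrite -(big_nth 0 xpredT (fun x => x ^+ 2)).
by apply: perm_big; rewrite perm_sym perm_sort.
Qed.

Lemma half_energy_indexP : (0 < size d)%N ->
  [/\ (0 < k)%N, (k <= size d)%N &
    \sum_(k <= i < size s) s`_i ^+ 2 <= \sum_(0 <= i < k) s`_i ^+ 2].
Proof.
move=> d_gt0; rewrite /k /half_energy_index.
set p := fun _ => _.
have hasp : has p (iota 0 (size s).+1).
  apply/hasP; exists (size s); first by rewrite mem_iota /= ltnS.
  rewrite /p size_sort d_gt0 /= [leLHS]big_geq ?size_sort //.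
  by apply: sumr_ge0 => i _; exact: sqr_ge0.
have := nth_find 0 hasp; move: hasp; rewrite has_find size_iota => lt_find.
rewrite nth_iota // add0n => /andP[k_gt0 ?]; split=> //.
by move: lt_find; rewrite ltnS [leqRHS]size_sort.
Qed.

Lemma sum_half_energy_ge : (0 < size d)%N ->
  \sum_(x <- d) x ^+ 2 <= 2 * \sum_(0 <= i < k) s`_i ^+ 2.
Proof.
move=> /half_energy_indexP[_ le_k le_half]; rewrite sum_sort_sq.
rewrite (big_cat_nat (n := k)) ?size_sort //=; move: le_half.
by rewrite size_sort; lra.
Qed.

(** Covers the default value of [rho]. If [k > 1] and [d_k = 0], the tail after [k - 1] terms
    already vanishes, so [k - 1] qualifies against minimality; if [k = 1], the largest entry is
    0. *)
Lemma half_energy_eq0 : (0 < size d)%N -> s`_k.-1 = 0 -> \sum_(x <- d) x ^+ 2 = 0.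
Proof.
move=> d_gt0; have [k_gt0 le_k _] := half_energy_indexP d_gt0.
have := sum_half_energy_ge d_gt0.
have sum_ge0 : 0 <= \sum_(x <- d) x ^+ 2 by apply: sumr_ge0 => x _; exact: sqr_ge0.
case kE : k k_gt0 le_k => [//|j] _ lt_j le2 /= sj0.
case: j kE lt_j le2 sj0 => [|j] kE lt_j le2 sj0.
  by move: le2; rewrite big_nat1 sj0 expr2 mulr0 mulr0; lra.
suff : (0 < j.+1)%N && (\sum_(j.+1 <= i < size s) s`_i ^+ 2 <=
                      \sum_(0 <= i < j.+1) s`_i ^+ 2).
  have := @before_find _ 0 (fun k => (0 < k)%N &&
    (\sum_(k <= i < size s) s`_i ^+ 2 <= \sum_(0 <= i < k) s`_i ^+ 2))
    (iota 0 (size s).+1) j.+1.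
  rewrite -/(half_energy_index s) -/k kE nth_iota ?size_sort; last first.
    by rewrite ltnS ltnW.
  by rewrite add0n => /(_ (ltnSn _)) ->.
rewrite /= big_nat_cond big1 => [|i /andP[/andP[le_i _] _]].
  by apply: sumr_ge0 => i _; exact: sqr_ge0.
suff -> : s`_i = 0 by rewrite expr2 mulr0.
apply/eqP; rewrite eq_le nth_sort_ge0 andbT.
by apply: le_trans (nth_sort_le le_i) _; rewrite sj0.
Qed.

Lemma rho_ge1 : 1 <= rho d.
Proof.
rewrite /rho -/s -/k; case: ifP => // sk_neq0.
rewrite ler_pdivlMr; last by rewrite lt0r sk_neq0 nth_sort_ge0.
by rewrite mul1r nth_sort_le.
Qed.

(** By monotonicity the partial sums give the pointwise bound [weak], so the harmonic estimate
    applies to [s_i^2 / C^2]. *)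
Lemma sum_sq_le_rho (C : R) : (0 < size d)%N -> 0 <= C ->
  (forall j, (j <= size d)%N -> \sum_(0 <= i < j) s`_i <= C * Num.sqrt j%:R) ->
  \sum_(x <- d) x ^+ 2 <= 4 * (ln (rho d) + 1) * C ^+ 2.
Proof.
move=> d_gt0 C_ge0 leC.
have ln_rho : 0 <= ln (rho d) by rewrite ln_ge0 // rho_ge1.
have [k_gt0 le_k _] := half_energy_indexP d_gt0.
have [sk0|sk_neq0] := eqVneq s`_k.-1 0.
  rewrite half_energy_eq0 // mulr_ge0 ?sqr_ge0 // mulr_ge0 //; lra.
have sk_gt0 : 0 < s`_k.-1 by rewrite lt0r sk_neq0 nth_sort_ge0.
have weak i : (i < k)%N -> i.+1%:R * s`_i ^+ 2 <= C ^+ 2.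
  move=> lt_i; have S_pos : 0 < i.+1%:R :> R by rewrite ltr0n.
  have le1 : i.+1%:R * s`_i <= C * Num.sqrt i.+1%:R.
    apply: le_trans (leC _ (leq_trans lt_i le_k)).
    rewrite mulr_natl -[in leLHS](subn0 i.+1) -sumr_const_nat.
    apply: ler_sum_nat => j /andP[_ lt_j]; exact: nth_sort_le.
  have q_gt0 : 0 < Num.sqrt (i.+1%:R : R) by rewrite sqrtr_gt0.
  have qE : i.+1%:R = Num.sqrt (i.+1%:R : R) ^+ 2 by rewrite sqr_sqrtr // ltW.
  move: le1; rewrite {1}qE expr2 -mulrA mulrC ler_pM2r // => le1.
  by rewrite qE -exprMn ler_sqr // nnegrE mulr_ge0 ?nth_sort_ge0 // ltW.
have s0_gt0 : 0 < s`_0 by apply: lt_le_trans sk_gt0 _; exact: nth_sort_le.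
have C_gt0 : 0 < C ^+ 2.
  by apply: lt_le_trans (weak 0 k_gt0); rewrite mul1r exprn_gt0.
pose a := s`_0 ^+ 2 / C ^+ 2.
have a_gt0 : 0 < a by rewrite divr_gt0 // exprn_gt0.
have rhoE : rho d = s`_0 / s`_k.-1 by rewrite /rho -/s -/k sk_neq0.
(* From [weak] at the last index, [k * d_k^2 <= C^2]; multiplying by [a] and dividing by [d_k^2]
   leaves [d_1^2 / d_k^2]. *)
have ak : a * k%:R <= rho d ^+ 2.
  have := weak k.-1; rewrite prednK // => /(_ (leqnn _)) le_C.
  rewrite rhoE expr_div_n ler_pdivlMr ?exprn_gt0 // -mulrA.
  by apply: le_trans (ler_wpM2l (ltW a_gt0) le_C) _; rewrite divfK // gt_eqF.
have : \sum_(0 <= i < k) s`_i ^+ 2 / C ^+ 2 <= 2 + ln (Num.max 1 (a * k%:R)).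
  apply: sum_min_harmonic_le; first exact: ltW.
  - move=> i _; rewrite ler_pM2r ?invr_gt0 //.
    by rewrite ler_sqr ?nnegrE ?nth_sort_ge0 // nth_sort_le.
  - by move=> i lt_i; rewrite mulrA ler_pdivrMr // mul1r weak.
rewrite -mulr_suml ler_pdivrMr // => le_sum.
apply: le_trans (sum_half_energy_ge d_gt0) _.
(* The 4 of the claim is the 2 of the half energy times the 2 in [2 + 2 ln rho]. *)
apply: (@le_trans _ _ (2 * ((2 + ln (rho d) *+ 2) * C ^+ 2))); last by lra.
rewrite ler_pM2l // (le_trans le_sum) // ler_pM2r // lerD2l.
have rho_gt0 : 0 < rho d by apply: lt_le_trans rho_ge1.
rewrite -lnXn // ler_ln ?posrE ?lt_max ?ltr01 ?exprn_gt0 //.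
by rewrite ge_max ak andbT exprn_ege1 // rho_ge1.
Qed.

End SortedSequence.

Lemma sum_top_sort (R : realType) (T : finType) (w : T -> R) (j : nat) :
  (j <= #|T|)%N ->
  exists2 X : {set T}, #|X| = j &
    \sum_(0 <= i < j) (sort >=%R [seq w v | v <- enum T])`_i = \sum_(v in X) w v.
Proof.
move=> le_j; rewrite sort_map; set t := sort _ _.
(* By [sort_map], [t] sorts the vertices themselves by weight, so a prefix has no repetition even
   when weights coincide. *)
have ut : uniq (take j t) by rewrite take_uniq // sort_uniq enum_uniq.
have sz : size (take j t) = j.
  by rewrite size_takel // size_sort -cardE.
exists [set v in take j t]; first by rewrite cardsE (card_uniqP ut) sz.
transitivity (\sum_(v <- take j t) w v); last first.
  by rewrite big_uniq //; apply: eq_bigl => v; rewrite inE.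
rewrite -(big_map w xpredT id) map_take [RHS](big_nth 0) size_take size_map.
rewrite size_sort -cardE; case: ltngtP le_j => // [lt_j|->] _;
  by apply: eq_big_nat => i /andP[_ lt_i]; rewrite nth_take.
Qed.

(** * Square sums of functions controlled on sets *)

Section RestrictedWeakType.
Variables (R : realType) (T : finType) (w : T -> R) (C : R).
Hypotheses (T_gt0 : (0 < #|T|)%N) (C_ge0 : 0 <= C) (w_ge0 : forall v, 0 <= w v).
Hypothesis weak : forall X : {set T}, X != set0 ->
  \sum_(v in X) w v <= C * Num.sqrt #|X|%:R.
Let d := [seq w v | v <- enum T].

Let sz : size d = #|T|.
Proof. by rewrite size_map -cardE. Qed.

Let d_ge0 x : x \in d -> 0 <= x.
Proof. by case/mapP => v _ ->. Qed.

Let sum_d : \sum_(x <- d) x ^+ 2 = \sum_v w v ^+ 2.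
Proof. by rewrite big_map big_enum. Qed.

Let top j : (j <= size d)%N ->
  \sum_(0 <= i < j) (sort >=%R d)`_i <= C * Num.sqrt j%:R.
Proof.
rewrite sz => /(sum_top_sort w)[X <- ->].
have [->|] := eqVneq X set0; last exact: weak.
by rewrite big_set0 mulr_ge0 // sqrtr_ge0.
Qed.

Lemma sum_sq_le_ln_card :
  \sum_v w v ^+ 2 <= C ^+ 2 * ((ln #|T|%:R + 3) / 2).
Proof.
rewrite -sum_d sum_sort_sq size_sort sz.
apply: sum_sq_le_of_partial_sums => // [i|i|j]; first exact: nth_sort_ge0.
- exact: nth_sort_le.
- by rewrite -sz; exact: top.
Qed.

Lemma sum_sq_le_ln_rho :
  \sum_v w v ^+ 2 <= 4 * (ln (rho d) + 1) * C ^+ 2.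
Proof. by rewrite -sum_d; apply: sum_sq_le_rho => //; rewrite sz. Qed.

End RestrictedWeakType.

(** * Upper bound: degrees, neighbor sums and eigenvalues *)

Section Graph.
Variables (R : realType) (T : finType) (e : rel T).
Hypotheses (e_sym : symmetric e) (T_gt0 : (0 < #|T|)%N).
Implicit Types (X Y : {set T}) (f : T -> R).

Lemma degree_inE X v : (degree_in e X v)%:R = \sum_(x in X) (e v x)%:R :> R.
Proof.
rewrite /degree_in -sum1_card natr_sum big_mkcond [RHS]big_mkcond /=.
by apply: eq_bigr => x _; rewrite inE; case: (x \in X); case: (e v x).
Qed.

Lemma edge_countE X Y :
  (edge_count e X Y)%:R = \sum_(x in X) \sum_(y in Y) (e x y)%:R :> R.
Proof.
rewrite /edge_count -sum1_card natr_sum pair_big_dep /=.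
rewrite big_mkcond [RHS]big_mkcond /=; apply: eq_bigr => -[x y] _.
by rewrite inE /=; case: (x \in X); case: (y \in Y); case: (e x y).
Qed.

Lemma calM_ge0 : 0 <= calM R e.
Proof. exact: bigmax_ge_id. Qed.

Lemma edge_count_le_calM X Y : X != set0 -> Y != set0 ->
  (edge_count e X Y)%:R <= calM R e * Num.sqrt #|Y|%:R * Num.sqrt #|X|%:R.
Proof.
move=> X0 Y0; rewrite mulrAC -mulrA -sqrtrM ?ler0n //.
rewrite -ler_pdivrMr; last by rewrite sqrtr_gt0 mulr_gt0 // ltr0n card_gt0.
pose F (P : {set T} * {set T}) : R :=
  (edge_count e P.1 P.2)%:R / Num.sqrt (#|P.1|%:R * #|P.2|%:R).
by apply: (@le_bigmax_cond _ _ _ 0 (X, Y) _ F); rewrite /= X0.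
Qed.

Lemma max_rho_ge X : X != set0 ->
  rho [seq (degree_in e X v)%:R : R | v <- enum T] <= max_rho R e.
Proof. by move=> X0; exact: le_bigmax_cond. Qed.

Lemma rho_degree_ge1 X : 1 <= rho [seq (degree_in e X v)%:R : R | v <- enum T].
Proof. by apply: rho_ge1 => _ /mapP[v _ ->]; exact: ler0n. Qed.

Lemma max_rho_ge1 : 1 <= max_rho R e.
Proof.
apply: le_trans (rho_degree_ge1 setT) (max_rho_ge _).
by rewrite -card_gt0 cardsT.
Qed.

(** Summing the degrees into [X] over [Y] counts the edges between them, so [calM] supplies the set
    bound with [C = calM * sqrt #|X|]. *)
Lemma sum_degree_sq_le X : X != set0 ->
  \sum_v (degree_in e X v)%:R ^+ 2 <=
  4 * (ln (max_rho R e) + 1) * (calM R e ^+ 2 * #|X|%:R).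
Proof.
move=> X0; pose C := calM R e * Num.sqrt #|X|%:R.
have C_ge0 : 0 <= C by rewrite mulr_ge0 ?calM_ge0 ?sqrtr_ge0.
have <- : C ^+ 2 = calM R e ^+ 2 * #|X|%:R by rewrite exprMn sqr_sqrtr.
have weak Y : Y != set0 ->
    \sum_(v in Y) (degree_in e X v)%:R <= C * Num.sqrt #|Y|%:R.
  move=> Y0; have := edge_count_le_calM Y0 X0; rewrite edge_countE.
  by under eq_bigr do rewrite -degree_inE.
apply: le_trans (sum_sq_le_ln_rho T_gt0 C_ge0 _ weak) _ => [v|];
  first exact: ler0n.
rewrite ler_wpM2r ?sqr_ge0 // ler_wpM2l // lerD2r.
have rho_ge1X := rho_degree_ge1 X; have K_ge1 := max_rho_ge1.
by rewrite ler_ln ?posrE ?max_rho_ge //; lra.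
Qed.

Lemma sum_neighbor_sq_le f : (forall v, 0 <= f v) ->
  \sum_x (\sum_y (e x y)%:R * f y) ^+ 2 <=
  2 * (ln (max_rho R e) + 1) * (ln #|T|%:R + 4) * calM R e ^+ 2 *
  \sum_y f y ^+ 2.
Proof.
move=> f_ge0; set lnK := ln (max_rho R e); set G := \sum_y f y ^+ 2.
have lnK1_ge0 : 0 <= lnK + 1 by rewrite addr_ge0 // ln_ge0 // max_rho_ge1.
have G_ge0 : 0 <= G by apply: sumr_ge0 => y _; exact: sqr_ge0.
pose D := 4 * (lnK + 1) * calM R e ^+ 2 * G.
have D_ge0 : 0 <= D by rewrite !mulr_ge0 ?calM_ge0.
(* Duality: symmetry moves the adjacency operator from [f] to the indicator of [X], and
   Cauchy-Schwarz meets the degree bound. *)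
have weak X : X != set0 ->
    \sum_(x in X) \sum_y (e x y)%:R * f y <= Num.sqrt D * Num.sqrt #|X|%:R.
  move=> X0; rewrite exchange_big /=.
  have -> : \sum_y \sum_(x in X) (e x y)%:R * f y =
      \sum_y (degree_in e X y)%:R * f y.
    apply: eq_bigr => y _; rewrite degree_inE mulr_suml.
    by apply: eq_bigr => x _; rewrite e_sym.
  rewrite -sqrtrM //; apply: le_trans (ler_norm _) _.
  rewrite -sqrtr_sqr ler_sqrt ?(mulr_ge0 D_ge0) //.
  apply: le_trans (cauchy_schwarz _ _) _; rewrite -/G /D mulrAC ler_wpM2r //.
  by rewrite -(mulrA (4 * _)); exact: sum_degree_sq_le.
have w_ge0 x : 0 <= \sum_y (e x y)%:R * f y.
  by apply: sumr_ge0 => y _; rewrite mulr_ge0.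
apply: le_trans (sum_sq_le_ln_card T_gt0 (sqrtr_ge0 D) w_ge0 weak) _.
(* The set bound yields the factor [ln #|T|%:R + 3]; the difference to the claim is one nonnegative
   term. *)
rewrite sqr_sqrtr // -subr_ge0.
have -> : 2 * (lnK + 1) * (ln #|T|%:R + 4) * calM R e ^+ 2 * G -
    D * ((ln #|T|%:R + 3) / 2) = 2 * (lnK + 1) * calM R e ^+ 2 * G.
  by rewrite /D; field.
by rewrite !mulr_ge0 ?calM_ge0.
Qed.

(** Being uniform over all eigenvalues, this also shows that the set under the supremum in
    [largest_eigenvalue] is bounded above. *)
Lemma eigenvalue_le (a : R) : eigenvalue (adjacency R e) a ->
  a <= Num.sqrt (2 * (ln (max_rho R e) + 1) * (ln (#|T|%:R : R) + 4)) * calM R e.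
Proof.
case/eigenvalueP => v /rowP vA v_neq0.
pose f x := `|v 0 (enum_rank x)|.
have f_ge0 x : 0 <= f x by exact: normr_ge0.
pose G := \sum_y f y ^+ 2.
have G_gt0 : 0 < G.
  have [i vi] : exists i, v 0 i != 0.
    apply/existsP; apply: contraNT v_neq0 => /existsPn v0.
    by apply/eqP/rowP => i; rewrite mxE; apply/eqP; rewrite -[_ == _]negbK v0.
  rewrite /G (bigD1 (enum_val i)) //= ltr_pwDl //.
    by rewrite exprn_gt0 // /f enum_valK normr_gt0.
  by apply: sumr_ge0 => y _; exact: sqr_ge0.
have af x : `|a| * f x <= \sum_y (e x y)%:R * f y.
  rewrite /f -normrM; have := vA (enum_rank x).
  rewrite !mxE => <-; apply: le_trans (ler_norm_sum _ _ _) _.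
  rewrite (big_enum_val (fun y => (e x y)%:R * f y)).
  rewrite le_eqVlt; apply/orP; left; apply/eqP; apply: eq_bigr => j _.
  by rewrite mxE enum_rankK normrM normr_nat mulrC e_sym /f enum_valK.
set D := 2 * _ * _.
have K_ge1 := max_rho_ge1.
have D_ge0 : 0 <= D.
  by rewrite !mulr_ge0 // addr_ge0 // ln_ge0 // ler1n.
apply: le_trans (ler_norm a) _.
rewrite -(ler_sqr (x := `|a|)) ?nnegrE ?mulr_ge0 ?sqrtr_ge0 ?calM_ge0 //.
rewrite exprMn sqr_sqrtr // -(ler_pM2r G_gt0).
apply: le_trans (sum_neighbor_sq_le f_ge0).
rewrite mulr_sumr; apply: ler_sum => x _.
by rewrite -exprMn ler_sqr ?nnegrE ?mulr_ge0 // (le_trans _ (af x)) ?mulr_ge0.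
Qed.

(** * Lower bound: edge counts as values of the adjacency form *)

Lemma adjacency_sym : (adjacency R e)^T = adjacency R e.
Proof. by apply/matrixP => i j; rewrite !mxE e_sym. Qed.

Let vec f : 'rV[R]_#|T| := \row_i f (enum_val i).

Let bform1_vec f : bform 1%:M (vec f) (vec f) = \sum_x f x ^+ 2.
Proof.
rewrite bform1E (big_enum_val (fun x => f x ^+ 2)).
by apply: eq_bigr => i _; rewrite mxE.
Qed.

Let bform_vec f g : bform (adjacency R e) (vec f) (vec g) =
  \sum_x \sum_y f x * (e x y)%:R * g y.
Proof.
rewrite bformE (big_enum_val (fun x => \sum_y f x * (e x y)%:R * g y)).
apply: eq_bigr => i _.
rewrite (big_enum_val (fun y => f (enum_val i) * (e (enum_val i) y)%:R * g y)).
by apply: eq_bigr => j _; rewrite !mxE.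
Qed.

Let sum_indicator_sq X : \sum_x ((x \in X)%:R : R) ^+ 2 = #|X|%:R.
Proof.
rewrite -sum1_card natr_sum [RHS]big_mkcond; apply: eq_bigr => x _.
by case: (x \in X); rewrite ?expr1n // expr2 mulr0.
Qed.

Let bform_indicator X Y :
  bform (adjacency R e) (vec (fun x => (x \in X)%:R)) (vec (fun y => (y \in Y)%:R)) =
  (edge_count e X Y)%:R.
Proof.
rewrite bform_vec edge_countE [RHS]big_mkcond; apply: eq_bigr => x _.
case: ifP => _; last by rewrite big1 // => y _; rewrite !mul0r.
rewrite [RHS]big_mkcond; apply: eq_bigr => y _.
by case: ifP => _; rewrite mul1r ?mulr1 ?mulr0.
Qed.

(* Polarization; the term with the minus sign is controlled by passing to
   absolute values, which is where nonnegativity of the matrix enters. *)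
Lemma edge_count_le_rayleigh (mu : R) X Y :
  (forall u, bform (adjacency R e) u u <= mu * bform 1%:M u u) ->
  X != set0 -> Y != set0 ->
  (edge_count e X Y)%:R <= mu * Num.sqrt (#|X|%:R * #|Y|%:R).
Proof.
move=> le_mu X0 Y0; rewrite sqrtrM //.
set p := Num.sqrt _; set q := Num.sqrt _.
have p_gt0 : 0 < p by rewrite sqrtr_gt0 ltr0n card_gt0.
have q_gt0 : 0 < q by rewrite sqrtr_gt0 ltr0n card_gt0.
have pE : p ^+ 2 = #|X|%:R by rewrite sqr_sqrtr.
have qE : q ^+ 2 = #|Y|%:R by rewrite sqr_sqrtr.
pose x : T -> R := fun v => (v \in X)%:R; pose y : T -> R := fun v => (v \in Y)%:R.
have comb s t : s *: vec x + t *: vec y = vec (fun v => s * x v + t * y v).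
  by apply/rowP => i; rewrite !mxE.
(* The factors [q] and [p] give both scaled indicators the norm [p * q]. *)
pose z v := `|q * x v + (- p) * y v|.
have le_abs : - bform (adjacency R e) (q *: vec x + (- p) *: vec y)
      (q *: vec x + (- p) *: vec y) <=
    mu * bform 1%:M (q *: vec x + (- p) *: vec y) (q *: vec x + (- p) *: vec y).
  have <- : bform 1%:M (vec z) (vec z) =
      bform 1%:M (q *: vec x + (- p) *: vec y) (q *: vec x + (- p) *: vec y).
    rewrite comb !bform1_vec; apply: eq_bigr => v _.
    by rewrite real_normK ?num_real.
  apply: le_trans (le_mu (vec z)); rewrite comb !bform_vec -sumrN.
  apply: ler_sum => v _; rewrite -sumrN; apply: ler_sum => v' _.
  apply: le_trans (ler_norm _) _.
  by rewrite normrN !normrM normr_nat.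
have := le_mu (q *: vec x + p *: vec y); move: le_abs.
rewrite !bform_comb ?adjacency_sym ?trmx1 // !bform1_vec !sum_indicator_sq -pE -qE.
rewrite [bform _ (vec x) (vec y)]bform_indicator.
set c := _%:R; set b := bform 1%:M _ _; set a := bform _ (vec x) _.
set d := bform _ (vec y) _ => le1 le2.
(* Adding [le1] and [le2] cancels [a], [d] and the inner product, leaving [4 * (p * q) * c <= mu *
   (4 * (p * q) ^+ 2)]. *)
have pq_gt0 : 0 < 4 * (p * q) by rewrite !mulr_gt0.
by rewrite -(ler_pM2l pq_gt0); lra.
Qed.

End Graph.

Theorem theorem3 (R : realType) (T : finType) (e : rel T)
    (e_sym : symmetric e) (e_irr : irreflexive e) (T_gt0 : (0 < #|T|)%N) :
  calM R e <= lambda_max R e /\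
  lambda_max R e <=
    Num.sqrt (2 * (ln (max_rho R e) + 1) * (ln (#|T|%:R : R) + 4)) * calM R e.
Proof.
have [mu ev_mu le_mu] := rayleigh_eigenvalue T_gt0 (adjacency_sym R e_sym).
have ub := @eigenvalue_le R T e e_sym T_gt0.
have ev0 : ([set a : R | eigenvalue (adjacency R e) a] !=set0)%classic by exists mu.
split; last exact: ge_sup ev0 ub.
have mu_le : mu <= lambda_max R e.
  by apply: ub_le_sup => //; eexists => a; exact: ub.
apply: le_trans mu_le; apply: bigmax_le => [|[X Y] /= /andP[X0 Y0]].
  (* The default 0 of the maximum must be at most [mu]; the pair of full vertex sets shows it. *)
  have TX0 : [set: T] != set0 by rewrite -card_gt0 cardsT.
  have := edge_count_le_rayleigh e_sym le_mu TX0 TX0.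
  move=> /(le_trans (ler0n _ _)); rewrite pmulr_lge0 //.
  by rewrite sqrtr_gt0 mulr_gt0 // ltr0n cardsT.
rewrite ler_pdivrMr; first exact: edge_count_le_rayleigh.
by rewrite sqrtr_gt0 mulr_gt0 // ltr0n card_gt0.
Qed.
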